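(* Let $\|\cdot\|$ be an arbitrary norm on $\mathbb{R}^n$ with dual norm $\|\cdot\|_*$. Let $\mathcal{Z}\subset\mathbb{R}^n$ be nonempty, closed and convex (not necessarily bounded). Let $f,g:\mathbb{R}^n\to\mathbb{R}$ be such that: $g$ is convex and continuously differentiable on an open set containing $\mathcal{Z}$, and $\|\nabla g(x)-\nabla g(y)\|_*\le L_g\|x-y\|$ for all $x,y\in\mathcal{Z}$; $f$ is convex and continuously differentiable and its gradient is Lipschitz with constant $L_f$. Let $x^*$ be an optimal solution of the bilevel problem $\min f(x)$ subject to $x\in\mathcal{X}_g^*:=\operatorname{argmin}_{z\in\mathcal{Z}}g(z)$, and let $g^*=g(x^* )=\min_{z\in\mathcal{Z}}g(z)$. Suppose $g$ satisfies the Hölderian error bound with $r=1$ and some $\alpha>0$: $$\alpha\operatorname{dist}(x,\mathcal{X}_g^* )\le g(x)-g^*\qquad\text{for all }x\in\mathcal{Z}.$$ Let $M=\max_{x\in\mathcal{X}_g^*}\|\nabla f(x)\|$. Let $\{x_k\}_{k\ge0}$ be the sequence of iterates generated by the AGM-BiO algorithm (defined in the context) from $x_0=z_0\in\mathbb{R}^n$ with stepsizes $a_k=\gamma\frac{k+1}{4L_f}$, where $$0<\gamma\le\min\left\{\frac{2\alpha L_f}{2ML_g+\alpha L_f},\,1\right\},$$ and suppose the real sequence $\{g_k\}_{k\ge0}$ used for generating the cutting planes satisfies $0\le g_k-g^*\le\frac{2L_g\|x_0-x^*\|^2}{(k+1)^2}$ for all $k\ge0$. Define $C_f=4L_f\|x_0-x^*\|^2$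 and $C_g=8L_g\|x_0-x^*\|^2$. Then for every integer $k\ge1$: (i) $$f(x_k)-f(x^* )\le\frac{C_f}{\gamma k(k+1)};$$ (ii) $$f(x_k)-f(x^* )\ge-\frac{C_gM(\ln k+1)}{\alpha k(k+1)}-\frac{C_f}{\gamma k(k+1)};$$ (iii) (read for $M>0$) $$g(x_k)-g(x^* )\le\frac{C_g(\ln k+1)}{k(k+1)}+\frac{\alpha C_f}{\gamma Mk(k+1)}.$$
   Context: $\langle\cdot,\cdot\rangle$ is the standard inner product on $\mathbb{R}^n$, $\Pi_{S}$ denotes the Euclidean projection onto a nonempty closed convex set $S$, and $\operatorname{dist}(x,S)=\inf_{x'\in S}\|x-x'\|$. The AGM-BiO algorithm with stepsizes $a_k>0$ and sequence $\{g_k\}$: set $A_0=0$ and take $x_0=z_0\in\mathbb{R}^n$. For $k=0,1,2,\dots$ compute $$y_k=\frac{A_k}{A_k+a_k}x_k+\frac{a_k}{A_k+a_k}z_k,$$ $$\mathcal{X}_k=\{z\in\mathcal{Z}:\ g(y_k)+\langle\nabla g(y_k),z-y_k\rangle\le g_k\},\qquad z_{k+1}=\Pi_{\mathcal{X}_k}\big(z_k-a_k\nabla f(y_k)\big),$$ $$x_{k+1}=\frac{A_k}{A_k+a_k}x_k+\frac{a_k}{A_k+a_k}z_{k+1},\qquad A_{k+1}=A_k+a_k.$$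
   Formalization: The norm is assumed at most the Euclidean norm; ‖x_0−x*‖ (in C_f, C_g and the g_k bound) and the Lipschitz condition on ∇f are Euclidean; M uses the dual norm; g's convexity, smoothness and L_g-Lipschitz gradient are assumed on the convex hull of Z and x_0. *)

(* Defs.v *)
(* MathComp-Analysis; R is any realType, vectors of R^n are rows 'rV[R]_n
   (their library norm is the sup norm and only provides the topology). *)
From HB Require Import structures.
From mathcomp Require Export all_boot all_order all_algebra.
From mathcomp Require Export all_classical all_reals all_analysis.
Import Order.TTheory GRing.Theory Num.Theory.
Export numFieldNormedType.Exports.

Set Implicit Arguments.
Unset Strict Implicit.
Unset Printing Implicit Defensive.

Local Open Scope classical_set_scope.
Local Open Scope ring_scope.

Section Euclidean.
Context {R : realType} {n : nat}.
Implicit Types (u v x p q : 'rV[R]_n) (S : set 'rV[R]_n).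

Definition dotv u v : R := \sum_(i < n) u 0 i * v 0 i.

Definition enorm u : R := Num.sqrt (dotv u u).

Definition is_eproj S p q : Prop :=
  S q /\ forall s, S s -> enorm (p - q) <= enorm (p - s).

End Euclidean.

Section Norms.
Context {R : realType} {n : nat}.
Implicit Types (N : 'rV[R]_n -> R) (x v : 'rV[R]_n) (S : set 'rV[R]_n).

Record is_norm N : Prop := IsNorm {
  is_norm_triangle : forall x y, N (x + y) <= N x + N y ;
  is_norm_homog : forall (c : R) x, N (c *: x) = `|c| * N x ;
  is_norm_eq0 : forall x, N x = 0 -> x = 0 }.

Definition dual_norm N v : R := sup [set dotv v x | x in [set x | N x <= 1]].

Definition dist N x S : R := inf [set N (x - x') | x' in S].

End Norms.

Section Functions.
Context {R : realType} {n : nat}.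
Implicit Types (f g : 'rV[R]_n -> R) (U Z : set 'rV[R]_n) (x : 'rV[R]_n).

Definition grad f x : 'rV[R]_n := \row_(i < n) 'D_(delta_mx 0 i) f x.

(* meaningful for U open *)
Definition C1_on U f : Prop :=
  forall x, U x -> differentiable f x /\ {for x, continuous (grad f)}.

Definition convex_on U f : Prop := convex_function (E := 'rV[R]_n) U f.

Definition argmin_on f Z : set 'rV[R]_n :=
  [set x | Z x /\ forall z, Z z -> f x <= f z].

(* Union of the segments joining x0 to the points of Z: for Z convex and
   nonempty this is the convex hull of Z and x0, and it is Z if x0 is in Z.
   The first query point y 0 of agm_bio is x0, which may lie outside Z; the
   segment from y 0 to x 1, where g must be smooth, then lies in this set. *)
Definition join_point Z x0 : set 'rV[R]_n :=
  [set p | exists z (t : R),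
    [/\ Z z, 0 <= t, t <= 1 & p = (1 - t) *: z + t *: x0]].

Lemma join_point_id Z x0 :
  convex_set (M := 'rV[R]_n) Z -> Z x0 -> join_point Z x0 = Z.
Proof.
move=> cZ Zx0; apply/seteqP; split => [p [z [t [Zz t0 t1 ->]]]|p Zp]; last first.
  by exists p, 0; split => //; rewrite ?ler01 // subr0 scale1r scale0r addr0.
have t01 : Itv.spec (@Itv.num_sem R) (Itv.Real `[0%Z, 1%Z]) t.
  by rewrite /Itv.spec /= /Itv.num_sem /= in_itv /= t0 t1 andbT realE t0.
have := cZ x0 z (Itv.mk t01) (mem_set Zx0) (mem_set Zz).
by rewrite inE addrC.
Qed.

End Functions.

Definition is_max {R : realType} (E : set R) (m : R) : Prop :=
  E m /\ ubound E m.

Section Algorithm.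
Context {R : realType} {n : nat}.

Definition cut_set (Z : set 'rV[R]_n) (g : 'rV[R]_n -> R) (gk : R)
    (y : 'rV[R]_n) : set 'rV[R]_n :=
  [set z | Z z /\ g y + dotv (grad g y) (z - y) <= gk].

Record agm_bio (Z : set 'rV[R]_n) (f g : 'rV[R]_n -> R) (a gs : nat -> R)
    (x0 : 'rV[R]_n) (x y z : nat -> 'rV[R]_n) (A : nat -> R) : Prop := AgmBio {
  agm_A0 : A 0 = 0 ;
  agm_x0 : x 0 = x0 ;
  agm_z0 : z 0 = x0 ;
  agm_y : forall k, y k =
    (A k / (A k + a k)) *: x k + (a k / (A k + a k)) *: z k ;
  agm_z : forall k, is_eproj (cut_set Z g (gs k) (y k))
    (z k - a k *: grad f (y k)) (z k.+1) ;
  agm_x : forall k, x k.+1 =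
    (A k / (A k + a k)) *: x k + (a k / (A k + a k)) *: z k.+1 ;
  agm_A : forall k, A k.+1 = A k + a k }.

End Algorithm.

(* Main.v *)
From mathcomp Require Import ring lra.
Require Import Defs.
Import Order.TTheory GRing.Theory Num.Theory.

(** The proof is an estimate-sequence argument with two Lyapunov inequalities
that share one error term, the path length
[S_k = \sum_(i < k) |z_(i+1) - z_i|^2].

Both [f] and [g] are smooth and convex along the iterates, and
[x_(k+1) - y_k] is a small multiple of [z_(k+1) - z_k]; so for either function
[h] the value [A_(k+1) h (x_(k+1))] is at most [A_k h (x_k)], plus [a_k] times
the linearization of [h] at [y_k] evaluated in [z_(k+1)], plus a multiple of
[|z_(k+1) - z_k|^2] ([coupling_descent]).

For [f], the point [xs] satisfies every cutting plane, since linearizations of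
a convex function lie below it and [g xs <= gs k]. The projection inequality
then bounds the linearization term by a telescoping difference of the
[|z_k - xs|^2 / 2], minus [|z_(k+1) - z_k|^2 / 2]. Since [a_k^2] is at most a
small multiple of [A_(k+1)] ([step_ratio]), the latter absorbs the smoothness
error and leaves a surplus ([energy_f]):
[A_k (f (x_k) - f xs) + (2 - gamma) / 4 * S_k <= |x0 - xs|^2 / 2].
Dropping [S_k] gives the upper bound on [f (x_k) - f xs].

For [g], the cutting plane itself bounds the linearization term by [gs k]
([energy_g]): up to the sum of the [a_i (gs i - g xs)], which is logarithmic,
[A_k (g (x_k) - g xs)] is at most [Lg gamma / (4 Lf) * S_k].

What couples them is that [f (x_k)] cannot be far below [f xs] unless [x_k] is
far from the solution set of the lower level: by convexity of [f],
[f xs - f (x_k) <= M * dist], and the error bound turns this into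
[alpha (f xs - f (x_k)) <= M (g (x_k) - g xs)]. The bound on [gamma] says
exactly that [M] times the multiple of [S_k] charged to [g] is at most half of
[alpha] times the surplus left by [f]. Hence, eliminating [S_k], half of
[M A_k (g (x_k) - g xs)] is absorbed ([weighted_gap_le]). This is the bound on
[g], and through the previous display it is also the lower bound on [f].

The passage between a norm and its dual rests on [dotv_le_dual], which holds
because every norm on [R^n] dominates a multiple of the sup norm, so that the
supremum defining the dual norm is finite. *)

Local Open Scope classical_set_scope.
Local Open Scope ring_scope.

(** * Euclidean geometry *)

Section EuclideanGeometry.
Context {R : realType} {n : nat}.
Implicit Types (u v w : 'rV[R]_n) (S : set 'rV[R]_n).

Lemma dotvC u v : dotv u v = dotv v u.
Proof. by apply: eq_bigr => i _; rewrite mulrC. Qed.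

Lemma dotvDr u v w : dotv u (v + w) = dotv u v + dotv u w.
Proof. by rewrite -big_split /=; apply: eq_bigr => i _; rewrite mxE mulrDr. Qed.

Lemma dotvZr c u v : dotv u (c *: v) = c * dotv u v.
Proof. by rewrite mulr_sumr; apply: eq_bigr => i _; rewrite mxE mulrCA. Qed.

Lemma dotvBr u v w : dotv u (v - w) = dotv u v - dotv u w.
Proof. by rewrite dotvDr -scaleN1r dotvZr mulN1r. Qed.

Lemma dotv0r u : dotv u 0 = 0.
Proof. by rewrite -(scale0r (0 : 'rV[R]_n)) dotvZr mul0r. Qed.

Lemma dotvBl u v w : dotv (u - v) w = dotv u w - dotv v w.
Proof. by rewrite dotvC dotvBr !(dotvC w). Qed.

Lemma dotvv_ge0 u : 0 <= dotv u u.
Proof. by apply: sumr_ge0 => i _; rewrite -expr2 sqr_ge0. Qed.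

Lemma enorm_ge0 u : 0 <= enorm u.
Proof. exact: sqrtr_ge0. Qed.

Lemma enorm_sqr u : enorm u ^+ 2 = dotv u u.
Proof. by rewrite sqr_sqrtr // dotvv_ge0. Qed.

Lemma enormZ_sqr c u : enorm (c *: u) ^+ 2 = c ^+ 2 * enorm u ^+ 2.
Proof. by rewrite !enorm_sqr dotvZr dotvC dotvZr mulrA. Qed.

Lemma enormB_sqr u v :
  enorm (u - v) ^+ 2 = enorm u ^+ 2 - 2 * dotv u v + enorm v ^+ 2.
Proof. by rewrite !enorm_sqr !dotvBl !dotvBr (dotvC v u); ring. Qed.

(** With [a] and [b] the norms of [u] and [v], the square of [b u - a v] equals
[2 a b (a b - dotv u v)]; this decides the claim unless [u] or [v] is 0. *)
Lemma CauchySchwarz_dotv u v : dotv u v <= enorm u * enorm v.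
Proof.
have key : 0 <= enorm u * enorm v * (enorm u * enorm v - dotv u v).
  have := sqr_ge0 (enorm (enorm v *: u - enorm u *: v)).
  rewrite enormB_sqr !enormZ_sqr dotvZr dotvC dotvZr (dotvC v u); nra.
have [pos|] := ltP 0 (enorm u * enorm v).
  by move: key; rewrite pmulr_rge0 // subr_ge0.
have zero w : enorm w = 0 -> w = 0.
  move=> /eqP; rewrite sqrtr_eq0 => w0; apply/rowP => i; rewrite mxE.
  have /eqP : dotv w w = 0 by apply/eqP; rewrite eq_le w0 dotvv_ge0.
  rewrite psumr_eq0 => [/allP /(_ i)|j _]; last by rewrite -expr2 sqr_ge0.
  by rewrite mem_index_enum -expr2 sqrf_eq0 => /(_ isT) /eqP.
move=> np; have : enorm u * enorm v == 0.
  by rewrite eq_le np mulr_ge0 ?enorm_ge0.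
rewrite mulf_eq0 => /orP [] /eqP e0; rewrite e0 (zero _ e0).
  by rewrite dotvC dotv0r mul0r.
by rewrite dotv0r mulr0.
Qed.

(** Moving from the projection [q] towards [s] by a factor [t] changes the
squared distance to [p] by [- 2 t * dotv (p - q) (s - q) + O(t^2)], which cannot
be negative. *)
Lemma eproj_variational S p q s :
  is_eproj S p q -> (forall t, 0 < t -> t <= 1 -> S (q + t *: (s - q))) ->
  dotv (p - q) (s - q) <= 0.
Proof.
move=> [_ qmin] seg; rewrite leNgt; apply/negP => pos.
have ineq t : 0 < t -> t <= 1 ->
    2 * dotv (p - q) (s - q) <= t * enorm (s - q) ^+ 2.
  move=> t0 t1; have := qmin _ (seg t t0 t1).
  rewrite -(ler_pXn2r (n := 2)) ?nnegrE ?enorm_ge0 // opprD addrA.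
  rewrite (enormB_sqr (p - q)) enormZ_sqr dotvZr; nra.
have E0 := sqr_ge0 (enorm (s - q)).
set d := dotv _ _ in pos ineq; set E := enorm _ ^+ 2 in ineq E0.
have dE : 0 < d + E by lra.
(* The quadratic term wins only for t beyond 2 d / E; d / (d + E) is a valid
   factor below that threshold which makes sense even if E = 0. *)
have := ineq (d / (d + E)) (divr_gt0 pos dE).
rewrite ler_pdivrMr // mul1r -mulrA mulrCA => /(_ _).
have : E / (d + E) <= 1 by rewrite ler_pdivrMr //; lra.
move=> ? /(_ ltac:(lra)); nra.
Qed.

End EuclideanGeometry.

(** * Norms on a finite-dimensional space and their duals *)

Section NormDuality.
Context {R : realType} {n : nat}.
Context {N : 'rV[R]_n -> R} (N_norm : is_norm N).
Implicit Types u v : 'rV[R]_n.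

Lemma is_norm0 : N 0 = 0.
Proof. by rewrite -(scale0r (0 : 'rV[R]_n)) is_norm_homog // normr0 mul0r. Qed.

Lemma is_norm_ge0 v : 0 <= N v.
Proof.
have := is_norm_triangle N_norm v (-1 *: v).
rewrite is_norm_homog // normrN1 mul1r scaleN1r subrr is_norm0; lra.
Qed.

Lemma is_normB_dist u v : `|N u - N v| <= N (u - v).
Proof.
have := is_norm_triangle N_norm (u - v) v; rewrite subrK.
have := is_norm_triangle N_norm (-1 *: (u - v)) u.
rewrite is_norm_homog // normrN1 mul1r scaleN1r opprB subrK ler_norml.
by move=> *; lra.
Qed.

Lemma sup_norm_entry v i : `|v 0 i| <= `|v|.
Proof.
rewrite [leRHS]mx_normrE.
by rewrite (le_bigmax_cond _ (fun j => `|v j.1 j.2|) (j := (0, i))).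
Qed.

Lemma is_norm_le_sup v : N v <= (\sum_i N (delta_mx 0 i)) * `|v|.
Proof.
rewrite {1}[v]row_sum_delta mulr_suml.
elim/big_ind2 : _ => [|a a' b b' ha hb|i _]; first by rewrite is_norm0.
  by rewrite (le_trans (is_norm_triangle N_norm _ _)) ?lerD.
by rewrite is_norm_homog // mulrC ler_wpM2l ?is_norm_ge0 ?sup_norm_entry.
Qed.

Lemma is_norm_continuous : continuous N.
Proof.
move=> v; apply/(@cvgrPdist_lt _ _ _ _ (nbhs_filter v)) => e e0.
set K := \sum_i N (delta_mx 0 i).
have K0 : 0 <= K by apply: sumr_ge0 => i _; exact: is_norm_ge0.
have r0 : 0 < e / (K + 1) by rewrite divr_gt0 // ltr_wpDl.
apply: filterS (nbhsx_ballx v _ r0) => u; rewrite -ball_normE /=.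
rewrite ltr_pdivlMr ?ltr_wpDl // => vu.
apply: le_lt_trans (is_normB_dist _ _) _.
apply: le_lt_trans (is_norm_le_sup _) _; rewrite -/K.
have := normr_ge0 (v - u); nra.
Qed.

(** Half of the equivalence of norms: the continuous function [N] attains a
positive minimum on the compact unit sphere of the sup norm. If that sphere is
empty, the space is trivial. *)
Lemma sup_norm_le_is_norm : exists2 c : R, 0 < c & forall v, c * `|v| <= N v.
Proof.
pose S := [set v : 'rV[R]_n | `|v| = 1].
have normalize v : v != 0 -> S (`|v|^-1 *: v).
  by move=> v0; rewrite /S /= normrZ normfV normr_id mulVf // normr_eq0.
have [[u Su]|S0] := pselect (S !=set0); last first.
  exists 1 => // v; rewrite mul1r.
  have [->|v0] := eqVneq v 0; first by rewrite normr0 is_norm0.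
  by case: S0; exists (`|v|^-1 *: v); exact: normalize.
have Sc : compact S.
  apply: bounded_closed_compact.
    by exists 1; split => // r r1 v /= ->; rewrite ltW.
  have -> : S = (fun v => `|v|) @^-1` [set 1] by [].
  apply: closed_comp => [v _|]; [exact: norm_continuous | exact: closed_eq].
have [||c Sc1 cmin] := compact_EVT_min (f := N) _ Sc.
- by exists u.
- exact/continuous_subspaceT/is_norm_continuous.
have c0 : 0 < N c.
  rewrite lt_def is_norm_ge0 andbT; apply/eqP => /(is_norm_eq0 N_norm) c0.
  by move: Sc1; rewrite inE /S /= c0 normr0 => /esym/eqP; rewrite oner_eq0.
exists (N c) => // v.
have [->|v0] := eqVneq v 0; first by rewrite normr0 mulr0 is_norm0.
have := cmin _ (mem_set (normalize _ v0)).
rewrite is_norm_homog // normfV normr_id mulrC ler_pdivlMr ?normr_gt0 //.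
Qed.

(** The set whose supremum defines the dual norm is bounded, because [N]
dominates a multiple of the sup norm. *)
Lemma dual_norm_ubound v x : N x <= 1 -> dotv v x <= dual_norm N v.
Proof.
move=> x1; apply: ub_le_sup; last by exists x.
have [c c0 cN] := sup_norm_le_is_norm.
exists ((\sum_i `|v 0 i|) / c) => _ [w /= w1 <-].
rewrite ler_pdivlMr //.
have vw : dotv v w <= (\sum_i `|v 0 i|) * `|w|.
  rewrite mulr_suml; apply: ler_sum => i _.
  rewrite (le_trans (ler_norm _)) // normrM ler_wpM2l //.
  exact: sup_norm_entry.
have V0 : 0 <= \sum_i `|v 0 i| by apply: sumr_ge0.
have := cN w; have := normr_ge0 w; nra.
Qed.

Lemma dual_norm_ge0 v : 0 <= dual_norm N v.
Proof. by rewrite -(dotv0r v) dual_norm_ubound // is_norm0. Qed.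

Lemma dotv_le_dual v x : dotv v x <= dual_norm N v * N x.
Proof.
have [/(is_norm_eq0 N_norm) ->|Nx0] := eqVneq (N x) 0.
  by rewrite dotv0r is_norm0 mulr0.
have Nx : 0 < N x by rewrite lt_def Nx0 is_norm_ge0.
rewrite -ler_pdivrMr // mulrC -dotvZr dual_norm_ubound //.
by rewrite is_norm_homog // normfV ger0_norm ?is_norm_ge0 // mulVf.
Qed.

End NormDuality.

(** * First-order inequalities for smooth and for convex functions *)

Section Gradients.
Context {R : realType} {n : nat}.
Implicit Types (h : 'rV[R]_n -> R) (u v d : 'rV[R]_n) (U : set 'rV[R]_n).

Lemma derive_grad h u d : differentiable h u -> 'D_d h u = dotv (grad h u) d.
Proof.
move=> dh; rewrite deriveE // {1}[d]row_sum_delta raddf_sum.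
apply: eq_bigr => i _.
by rewrite [LHS](linearZ_LR ('d h u)) /= -deriveE // mxE mulrC.
Qed.

(** Restricting to a line reduces the multivariate inequalities below to the
mean value theorem and to one-sided limits on the real line. *)
Lemma is_derive_line h u d (t : R) : differentiable h (u + t *: d) ->
  is_derive t 1 (fun s : R => h (u + s *: d)) (dotv (grad h (u + t *: d)) d).
Proof.
move=> dh.
have /= := derive_grad _ _ d dh.
have dd : derivable h (u + t *: d) d by exact: diff_derivable.
have E : (fun s => s^-1 *: ((h \o shift (u + t *: d)) (s *: d)
                           - h (u + t *: d)))
  = (fun s : R => s^-1 *: (((fun r => h (u + r *: d)) \o shift t) (s *: 1)
                           - h (u + t *: d))).
  apply/funext => s /=; congr (_ *: (h _ - _)).
  by rewrite [_ *: 1]mulr1 scalerDl addrCA.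
rewrite /derive E => D; apply: DeriveDef; last exact: D.
by move: dd; rewrite /derivable E.
Qed.

(** The descent lemma, with the Lipschitz condition on the gradient replaced by
its consequence along the segment, so that it serves any pair of a norm and its
dual. The function
[h (u + t d) - t * dotv (grad h u) d - C t^2 / 2] has a nonpositive derivative
on [0, 1]. *)
Lemma descent h u d (C : R) :
  (forall t : R, 0 <= t -> t <= 1 -> differentiable h (u + t *: d)) ->
  (forall t : R, 0 <= t -> t <= 1 ->
     dotv (grad h (u + t *: d) - grad h u) d <= C * t) ->
  h (u + d) <= h u + dotv (grad h u) d + C / 2.
Proof.
move=> dh lip.
pose phi := fun t : R =>
  h (u + t *: d) - dotv (grad h u) d * t - C / 2 * t ^+ 2.
have dphi (t : R) : 0 <= t -> t <= 1 ->
    is_derive t 1 phi (dotv (grad h (u + t *: d) - grad h u) d - C * t).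
  move=> t0 t1; have D := is_derive_line _ _ _ _ (dh t t0 t1).
  have -> : phi = (fun s : R => h (u + s *: d)) - (dotv (grad h u) d \*: id)
      - (C / 2) \*: (id ^+ 2 : R -> R) by [].
  apply: is_derive_eq.
  rewrite dotvBl; rewrite /GRing.scale /= ; lra.
have cphi : {within `[0, 1], continuous phi}.
  apply: derivable_within_continuous => t; rewrite in_itv /= => /andP[t0 t1].
  by have [] := dphi t t0 t1.
pose dphi' t := dotv (grad h (u + t *: d) - grad h u) d - C * t.
have [|c + E] := @MVT_segment R phi dphi' 0 1 ler01 _ cphi.
  move=> t; rewrite in_itv /= => /andP[t0 t1]; exact: dphi (ltW t0) (ltW t1).
rewrite in_itv /= => /andP[c0 c1].
have := lip c c0 c1; move: E.
by rewrite /phi /dphi' scale1r scale0r addr0 expr0n expr1n /=; lra.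
Qed.

Lemma in01_itv (t : R) :
  0 <= t -> t <= 1 -> Itv.spec (@Itv.num_sem R) (Itv.Real `[0%Z, 1%Z]) t.
Proof.
by move=> t0 t1; rewrite /Itv.spec /= /Itv.num_sem /= in_itv /= t0 t1 ger0_real.
Qed.

Lemma conv_segment u v (t : R) (t0 : 0 <= t) (t1 : t <= 1) :
  conv (Itv.mk (in01_itv t t0 t1)) (v : convex_lmodType 'rV[R]_n) u
  = u + t *: (v - u).
Proof.
by rewrite /conv /= /unstable.onem scalerBr scalerBl scale1r [RHS]addrCA.
Qed.

Lemma convex_set_segment (S : set 'rV[R]_n) u v (t : R) :
  convex_set (M := 'rV[R]_n) S -> S u -> S v -> 0 <= t -> t <= 1 ->
  S (u + t *: (v - u)).
Proof.
move=> cS Su Sv t0 t1; rewrite -(conv_segment u v t t0 t1).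
exact: set_mem (cS _ _ _ (mem_set Sv) (mem_set Su)).
Qed.

Lemma convex_on_segment U h u v (t : R) :
  convex_on U h -> U u -> U v -> 0 <= t -> t <= 1 ->
  h (u + t *: (v - u)) <= h u + t * (h v - h u).
Proof.
move=> cU Uu Uv t0 t1; rewrite -(conv_segment u v t t0 t1).
apply: le_trans (cU _ _ _ (mem_set Uv) (mem_set Uu)) _.
by rewrite convRE /= /unstable.onem; lra.
Qed.

(** The difference quotients of [h] from [u] towards [v] are at most
[h v - h u]; let the step tend to 0 from the right. *)
Lemma convex_first_order U h u v :
  convex_on U h -> U u -> U v -> differentiable h u ->
  h u + dotv (grad h u) (v - u) <= h v.
Proof.
move=> ch Uu Uv dh.
have := is_derive_line h u (v - u) 0; rewrite scale0r addr0 => /(_ dh) [D E].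
rewrite -lerBrDl -E /derive.
have D' : cvg ((fun t : R =>
    t^-1 *: (((fun s : R => h (u + s *: (v - u))) \o shift 0) (t *: 1)
             - h (u + 0 *: (v - u)))) @ (0 : R)^'+).
  by apply: cvgP; exact: cvg_dnbhs_at_right D.
rewrite cvg_at_rightE //; apply: limr_le => //.
near=> t.
have t0 : 0 < t by near: t; exact: nbhs_right_gt.
have t1 : t <= 1 by near: t; exact: nbhs_right_le.
rewrite /= [t *: 1]mulr1 addr0 scale0r addr0.
rewrite [_ *: _]mulrC ler_pdivrMr // [leRHS]mulrC lerBlDl.
exact: convex_on_segment ch Uu Uv (ltW t0) t1.
Unshelve. all: by end_near. Qed.

(** One step of the accelerated scheme, for either objective: the smoothness
bound at [y] is split along [(A + a) (x' - y) = A (x - y) + a (z' - y)], and the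
part along [x - y] is absorbed by convexity. The error is small because
[x' - y] is [z' - z] scaled by [a / (A + a)]. *)
Lemma coupling_descent h (x y z z' x' : 'rV[R]_n) (A a L : R) :
  0 <= A -> 0 < a ->
  y = (A / (A + a)) *: x + (a / (A + a)) *: z ->
  x' = (A / (A + a)) *: x + (a / (A + a)) *: z' ->
  h x' <= h y + dotv (grad h y) (x' - y) + L * enorm (x' - y) ^+ 2 / 2 ->
  h y + dotv (grad h y) (x - y) <= h x ->
  (A + a) * h x' <= A * h x + a * (h y + dotv (grad h y) (z' - y))
                    + L * a ^+ 2 / (2 * (A + a)) * enorm (z' - z) ^+ 2.
Proof.
move=> A0 a0 yE x'E hx' hx.
have Aa : 0 < A + a by lra.
have Aa0 : A + a != 0 by rewrite gt_eqF.
have x'y : x' - y = (a / (A + a)) *: (z' - z).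
  by rewrite x'E yE; apply/rowP => i; rewrite !mxE; ring.
have split_dot : (A + a) * dotv (grad h y) (x' - y) =
    A * dotv (grad h y) (x - y) + a * dotv (grad h y) (z' - y).
  rewrite -!dotvZr -dotvDr; congr dotv.
  by rewrite x'E yE; apply/rowP => i; rewrite !mxE; field.
have hxA : A * (h y + dotv (grad h y) (x - y)) <= A * h x.
  exact: ler_wpM2l.
have quad : (A + a) * (L * enorm (x' - y) ^+ 2 / 2) =
    L * a ^+ 2 / (2 * (A + a)) * enorm (z' - z) ^+ 2.
  by rewrite x'y enormZ_sqr; field.
have : (A + a) * h x' <=
    (A + a) * (h y + dotv (grad h y) (x' - y) + L * enorm (x' - y) ^+ 2 / 2).
  by rewrite ler_pM2l.
rewrite mulrDr quad mulrDr split_dot; lra.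
Qed.

End Gradients.

(** * The harmonic sum *)

(** The increment is controlled by [ln (1 - 1/(k+2)) <= - 1/(k+2)]. *)
Lemma harmonic_le_ln (R : realType) (k : nat) : (1 <= k)%N ->
  \sum_(i < k) (i.+1%:R^-1 : R) <= ln k%:R + 1.
Proof.
elim: k => // -[|k] IH _; first by rewrite big_ord1 invr1 ln1 add0r.
rewrite big_ord_recr /=.
have K : 0 < k.+2%:R :> R by rewrite ltr0n.
have K1 : 0 < k.+1%:R :> R by rewrite ltr0n.
have KE : k.+2%:R = k.+1%:R + 1 :> R by rewrite -natr1.
have E : 1 + - k.+2%:R^-1 = k.+1%:R / k.+2%:R :> R.
  have : k.+1%:R + 1 != 0 :> R by rewrite -KE gt_eqF.
  by rewrite KE; move: (k.+1%:R : R) => c c0; field.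
have := @le_ln1Dx R (- k.+2%:R^-1).
rewrite E ltrN2 invf_lt1 // ltr1n => /(_ isT).
rewrite ln_div ?posrE // lerBlDr => lnk.
apply: le_trans (lerD (IH isT) (lexx _)) _.
rewrite addrAC lerD2r -lerBrDr.
by rewrite addrC in lnk.
Qed.

(** * Where the iterates live, and the proximal step *)

Section Iterates.
Context {R : realType} {n : nat}.
Context {Z : set 'rV[R]_n} {f g : 'rV[R]_n -> R} {a gs : nat -> R}.
Context {x0 : 'rV[R]_n} {x y z : nat -> 'rV[R]_n} {A : nat -> R}.
Context (xyz_agm : agm_bio Z f g a gs x0 x y z A).
Context (a_gt0 : forall k, 0 < a k).
Context (Z_convex : convex_set (M := 'rV[R]_n) Z).

Lemma agm_A_ge0 k : 0 <= A k.
Proof.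
elim: k => [|k IH]; first by rewrite (agm_A0 xyz_agm).
by rewrite (agm_A xyz_agm) addr_ge0 // ltW.
Qed.

Lemma agm_y0 : y 0%N = x0.
Proof.
rewrite (agm_y xyz_agm) (agm_A0 xyz_agm) (agm_z0 xyz_agm) mul0r scale0r add0r.
by rewrite add0r divff ?gt_eqF // scale1r.
Qed.

Lemma agm_x1 : x 1%N = z 1%N.
Proof.
rewrite (agm_x xyz_agm) (agm_A0 xyz_agm) mul0r scale0r add0r.
by rewrite add0r divff ?gt_eqF // scale1r.
Qed.

Lemma agm_average_in k u v :
  Z u -> Z v -> Z ((A k / (A k + a k)) *: u + (a k / (A k + a k)) *: v).
Proof.
move=> Zu Zv.
have Aa : 0 < A k + a k by rewrite ltr_wpDl // agm_A_ge0.
have -> : (A k / (A k + a k)) *: u + (a k / (A k + a k)) *: v =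
    u + (a k / (A k + a k)) *: (v - u).
  by apply/rowP => i; rewrite !mxE; field; rewrite gt_eqF.
apply: convex_set_segment => //; first by rewrite divr_ge0 // ltW.
by rewrite ler_pdivrMr // mul1r lerDr agm_A_ge0.
Qed.

Lemma agm_z_in k : Z (z k.+1).
Proof. by have [[]] := agm_z xyz_agm k. Qed.

Lemma agm_x_in k : Z (x k.+1).
Proof.
elim: k => [|k IH]; first by rewrite agm_x1; exact: agm_z_in.
by rewrite (agm_x xyz_agm); apply: agm_average_in => //; exact: agm_z_in.
Qed.

Lemma agm_y_in k : Z (y k.+1).
Proof.
rewrite (agm_y xyz_agm).
by apply: agm_average_in; [exact: agm_x_in | exact: agm_z_in].
Qed.

Lemma sub_join_point : Z `<=` join_point Z x0.
Proof.
by move=> u Zu; exists u, 0; rewrite ler01 subr0 scale1r scale0r addr0.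
Qed.

Lemma agm_start_join : join_point Z x0 x0.
Proof.
exists (z 1%N), 1.
by rewrite ler01 lexx subrr scale0r scale1r add0r; split => //; exact: agm_z_in.
Qed.

Lemma agm_x_join k : join_point Z x0 (x k).
Proof.
case: k => [|k]; last exact/sub_join_point/agm_x_in.
by rewrite (agm_x0 xyz_agm); exact: agm_start_join.
Qed.

Lemma agm_y_join k : join_point Z x0 (y k).
Proof.
case: k => [|k]; last exact/sub_join_point/agm_y_in.
by rewrite agm_y0; exact: agm_start_join.
Qed.

(** The segment on which [g] must be smooth: it lies in [Z] except at the first
step, where it starts at [x0]. *)
Lemma agm_step_join k (t : R) : 0 <= t -> t <= 1 ->
  join_point Z x0 (y k + t *: (x k.+1 - y k)).
Proof.
move=> t0 t1; case: k => [|k]; last first.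
  apply: sub_join_point.
  exact: convex_set_segment Z_convex (agm_y_in k) (agm_x_in k.+1) t0 t1.
rewrite agm_y0; exists (x 1%N), (1 - t); split; [exact: agm_x_in|lra|lra|].
by apply/rowP => i; rewrite !mxE; ring.
Qed.

Lemma cut_set_segment gk u s v (t : R) :
  cut_set Z g gk u s -> cut_set Z g gk u v -> 0 <= t -> t <= 1 ->
  cut_set Z g gk u (s + t *: (v - s)).
Proof.
move=> [Zs cs] [Zv cv] t0 t1; split; first exact: convex_set_segment.
by move: cs cv; rewrite !(dotvBr, dotvDr, dotvZr); nra.
Qed.

(** The variational inequality of the projection, rewritten with the
polarization identity so that the distances to [v] telescope. *)
Lemma agm_prox k v : cut_set Z g (gs k) (y k) v ->
  a k * dotv (grad f (y k)) (z k.+1 - v) <=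
  (enorm (z k - v) ^+ 2 - enorm (z k.+1 - v) ^+ 2
   - enorm (z k.+1 - z k) ^+ 2) / 2.
Proof.
move=> cv; have proj := agm_z xyz_agm k.
have : dotv (z k - a k *: grad f (y k) - z k.+1) (v - z k.+1) <= 0.
  apply: (eproj_variational _ _ _ _ proj) => t t0 t1.
  by apply: cut_set_segment => //; [case: proj | exact: ltW].
rewrite !enorm_sqr !(dotvBr, dotvBl) !(dotvC (a k *: _)) !dotvZr.
rewrite !(dotvC _ (grad f (y k))) (dotvC (z k) v) (dotvC (z k.+1) v).
rewrite (dotvC (z k.+1) (z k)); lra.
Qed.

End Iterates.

(** * The two energy inequalities and their combination *)

Section Rates.
Context {R : realType} {n : nat}.
Context {N : 'rV[R]_n -> R} (N_norm : is_norm N)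
  (N_le : forall v : 'rV[R]_n, N v <= enorm v).
Context {Z : set 'rV[R]_n} (Z_convex : convex_set (M := 'rV[R]_n) Z).
Context {f g : 'rV[R]_n -> R} {Lf Lg alpha gamma M : R}.
Context {x0 xs : 'rV[R]_n} {gs : nat -> R}.
Context {x y z : nat -> 'rV[R]_n} {A : nat -> R} {U : set 'rV[R]_n}.
Context (ZU : join_point Z x0 `<=` U) (g_convex : convex_on U g)
  (g_C1 : C1_on U g) (Lg_ge0 : 0 <= Lg)
  (g_lip : forall u v, join_point Z x0 u -> join_point Z x0 v ->
     dual_norm N (grad g u - grad g v) <= Lg * N (u - v))
  (f_convex : convex_on setT f) (f_C1 : C1_on setT f)
  (Lf_gt0 : 0 < Lf)
  (f_lip : forall u v, enorm (grad f u - grad f v) <= Lf * enorm (u - v))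
  (xs_opt : argmin_on f (argmin_on g Z) xs)
  (gamma_gt0 : 0 < gamma)
  (xyz_agm : agm_bio Z f g (fun k => gamma * (k.+1%:R / (4 * Lf))) gs
     x0 x y z A)
  (gs_ge : forall k, g xs <= gs k).

Let a k := gamma * (k.+1%:R / (4 * Lf)).
Let D2 := enorm (x0 - xs) ^+ 2.
Let S k := \sum_(i < k) enorm (z i.+1 - z i) ^+ 2.

Let a_gt0 k : 0 < a k.
Proof. by rewrite mulr_gt0 // divr_gt0 // mulr_gt0. Qed.

Let A_ge0 := agm_A_ge0 xyz_agm a_gt0.

Lemma agm_A_eq k : A k = gamma * k%:R * k.+1%:R / (8 * Lf).
Proof.
elim: k => [|k IH]; first by rewrite (agm_A0 xyz_agm) mulr0 !mul0r.
rewrite (agm_A xyz_agm) IH -!natr1; move: (k%:R : R) => c.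
by field; rewrite gt_eqF.
Qed.

(** Here [a_k^2] is compared with [A_(k+1)]: both grow quadratically, and the
constant is the one that turns a smoothness constant [L] into an error
[L * gamma / (4 * Lf)]. *)
Lemma step_ratio k : a k ^+ 2 / (2 * (A k + a k)) <= gamma / (4 * Lf).
Proof.
rewrite ler_pdivrMr ?mulr_gt0 ?ltr_wpDl // -subr_ge0 agm_A_eq /a -!natr1.
have := ler0n R k; move: (k%:R : R) => c c0.
set r := (X in 0 <= X).
have -> : r = gamma ^+ 2 * (c + 1) / (16 * Lf ^+ 2).
  by rewrite /r; field; rewrite gt_eqF.
by rewrite divr_ge0 ?mulr_ge0 ?exprn_ge0 ?addr_ge0 // ltW.
Qed.

Lemma f_smooth u v :
  f v <= f u + dotv (grad f u) (v - u) + Lf * enorm (v - u) ^+ 2 / 2.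
Proof.
have := descent f u (v - u) (Lf * enorm (v - u) ^+ 2).
rewrite subrKC; apply => t t0 t1; first by have [] := f_C1 (u + t *: (v - u)) I.
apply: le_trans (CauchySchwarz_dotv _ _) _.
have := f_lip (u + t *: (v - u)) u; rewrite addrAC subrr add0r.
have -> : enorm (t *: (v - u)) = t * enorm (v - u).
  rewrite /enorm dotvZr dotvC dotvZr mulrA sqrtrM -?expr2 ?sqr_ge0 //.
  by rewrite sqrtr_sqr ger0_norm.
have := enorm_ge0 (v - u); nra.
Qed.

Lemma g_smooth_step k :
  g (x k.+1) <= g (y k) + dotv (grad g (y k)) (x k.+1 - y k)
                + Lg * enorm (x k.+1 - y k) ^+ 2 / 2.
Proof.
have seg := agm_step_join xyz_agm a_gt0 Z_convex k.
have := descent g (y k) (x k.+1 - y k) (Lg * enorm (x k.+1 - y k) ^+ 2).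
rewrite subrKC; apply => t t0 t1.
  by have [] := g_C1 _ (ZU _ (seg t t0 t1)).
apply: le_trans (dotv_le_dual N_norm _ _) _.
have := g_lip _ _ (seg t t0 t1) (agm_y_join xyz_agm a_gt0 Z_convex k).
rewrite addrAC subrr add0r (is_norm_homog N_norm) ger0_norm // => lip.
apply: le_trans (ler_wpM2r (is_norm_ge0 N_norm _) lip) _.
have NE : N (x k.+1 - y k) ^+ 2 <= enorm (x k.+1 - y k) ^+ 2.
  by rewrite ler_sqr ?nnegrE ?enorm_ge0 ?(is_norm_ge0 N_norm).
have := ler_wpM2l (mulr_ge0 Lg_ge0 t0) NE; lra.
Qed.

Lemma xs_in : Z xs. Proof. by have [[]] := xs_opt. Qed.

(** A linearization of [g] lies below [g], and [g xs <= gs k]. *)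
Lemma opt_in_cut k : cut_set Z g (gs k) (y k) xs.
Proof.
have yU := ZU _ (agm_y_join xyz_agm a_gt0 Z_convex k).
split; first exact: xs_in.
apply: le_trans (gs_ge k); apply: convex_first_order g_convex _ _ _ => //.
  exact/ZU/sub_join_point/xs_in.
by have [] := g_C1 _ yU.
Qed.

(** The projection inequality contributes [- |z_(k+1) - z_k|^2 / 2] and the
smoothness of [f] at most [gamma / 4] times the same square. The surplus
[(2 - gamma) / 4] is kept, since it has to pay for the error made on [g]. *)
Lemma energy_f k :
  A k * (f (x k) - f xs) + enorm (z k - xs) ^+ 2 / 2 + (2 - gamma) / 4 * S k
  <= D2 / 2.
Proof.
elim: k => [|k IH].
  by rewrite /S big_ord0 mulr0 addr0 (agm_A0 xyz_agm) mul0r add0r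
    (agm_z0 xyz_agm).
apply: le_trans IH; rewrite /S big_ord_recr /= -/(S k).
rewrite (agm_A xyz_agm) -/(a k).
have df u : differentiable f u by have [] := f_C1 u I.
have step := coupling_descent f _ _ _ _ _ _ _ Lf (A_ge0 k) (a_gt0 k)
  (agm_y xyz_agm k) (agm_x xyz_agm k) (f_smooth _ _)
  (convex_first_order _ _ _ _ f_convex I I (df _)).
have prox := agm_prox xyz_agm Z_convex k xs (opt_in_cut k).
have lin := convex_first_order _ _ (y k) xs f_convex I I (df _).
have := ler_wpM2l (ltW (a_gt0 k)) lin.
have zsplit : dotv (grad f (y k)) (z k.+1 - xs) =
    dotv (grad f (y k)) (z k.+1 - y k) - dotv (grad f (y k)) (xs - y k).
  by rewrite !dotvBr; ring.
rewrite zsplit in prox.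
have ratio : Lf * a k ^+ 2 / (2 * (A k + a k)) <= gamma / 4.
  have := ler_wpM2l (ltW Lf_gt0) (step_ratio k).
  by rewrite mulrA => /le_trans; apply; rewrite le_eqVlt; apply/orP; left;
    apply/eqP; field; rewrite gt_eqF.
have := ler_wpM2r (sqr_ge0 (enorm (z k.+1 - z k))) ratio.
move: step prox; rewrite -/(a k) !mulrDr.
lra.
Qed.

(** The linearization of [g] at [y k], evaluated at [z k.+1], is at most [gs k]
because [z k.+1] was projected onto the cutting plane. *)
Lemma energy_g k :
  A k * (g (x k) - g xs) <=
  \sum_(i < k) a i * (gs i - g xs) + Lg * gamma / (4 * Lf) * S k.
Proof.
elim: k => [|k IH].
  by rewrite /S !big_ord0 mulr0 addr0 (agm_A0 xyz_agm) mul0r.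
rewrite /S !big_ord_recr /= -/(S k).
rewrite (agm_A xyz_agm) -/(a k).
have yU := ZU _ (agm_y_join xyz_agm a_gt0 Z_convex k).
have [dg _] := g_C1 _ yU.
have xU := ZU _ (agm_x_join xyz_agm a_gt0 Z_convex k).
have lin := convex_first_order _ _ _ _ g_convex yU xU dg.
have step := coupling_descent g _ _ _ _ _ _ _ Lg (A_ge0 k) (a_gt0 k)
  (agm_y xyz_agm k) (agm_x xyz_agm k) (g_smooth_step k) lin.
have [[_ cut] _] := agm_z xyz_agm k.
have := ler_wpM2l (ltW (a_gt0 k)) cut.
have := ler_wpM2r (sqr_ge0 (enorm (z k.+1 - z k)))
  (ler_wpM2l Lg_ge0 (step_ratio k)).
rewrite !mulrA in IH step *.
lra.
Qed.

Context (M_max : is_max [set dual_norm N (grad f u) | u in argmin_on g Z] M).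

Lemma max_gradient_ge0 : 0 <= M.
Proof. by have [[u _ <-] _] := M_max; exact: dual_norm_ge0. Qed.

(** Linearizing [f] at any point [p] of the lower-level solution set gives
[f p - f u <= M * N (u - p)], and [f xs <= f p]. Take the infimum over [p]. *)
Lemma sharp_lower_bound u :
  - (f u - f xs) <= M * dist N u (argmin_on g Z).
Proof.
have M0 := max_gradient_ge0; have [_ Mub] := M_max.
have near_opt p : argmin_on g Z p -> - (f u - f xs) <= M * N (u - p).
  move=> Xp.
  have df : differentiable f p by have [] := f_C1 p I.
  have := convex_first_order _ _ p u f_convex I I df.
  have := dotv_le_dual N_norm (grad f p) (p - u).
  have -> : N (p - u) = N (u - p).
    by rewrite -opprB -scaleN1r (is_norm_homog N_norm) normrN1 mul1r.
  have := ler_wpM2r (is_norm_ge0 N_norm (u - p)) (Mub _ (imageP _ Xp)).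
  have := xs_opt.2 p Xp.
  rewrite !dotvBr; lra.
have [Xxs _] := xs_opt.
move: M0; rewrite le_eqVlt => /orP[/eqP M0|M0].
  by have := near_opt xs Xxs; rewrite -M0 !mul0r.
rewrite mulrC -ler_pdivrMr //; apply: lb_le_inf.
  by exists (N (u - xs)); exists xs.
by move=> _ [p Xp <-]; rewrite ler_pdivrMr // mulrC near_opt.
Qed.

Context (alpha_gt0 : 0 < alpha)
  (g_heb : forall u, Z u -> alpha * dist N u (argmin_on g Z) <= g u - g xs)
  (gs_le : forall k, gs k - g xs <= 2 * Lg * D2 / k.+1%:R ^+ 2)
  (gamma_le : gamma <= 2 * alpha * Lf / (2 * M * Lg + alpha * Lf)).

Lemma sum_cut_slack_le k : (1 <= k)%N ->
  \sum_(i < k) a i * (gs i - g xs) <=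
  gamma * Lg * D2 / (2 * Lf) * (ln k%:R + 1).
Proof.
move=> k1; have c0 : 0 <= gamma * Lg * D2 / (2 * Lf).
  by rewrite divr_ge0 ?mulr_ge0 ?enorm_ge0 ?(ltW gamma_gt0) ?(ltW Lf_gt0).
apply: le_trans (ler_wpM2l c0 (harmonic_le_ln R k k1)).
rewrite mulr_sumr; apply: ler_sum => i _.
apply: le_trans (ler_wpM2l (ltW (a_gt0 i)) (gs_le i)) _.
have i0 : i.+1%:R != 0 :> R by rewrite pnatr_eq0.
rewrite /a; move: (i.+1%:R : R) i0 => c i0.
rewrite le_eqVlt; apply/orP; left; apply/eqP.
by field; rewrite i0 gt_eqF.
Qed.

(** The role of the upper bound on [gamma]: the error that [energy_g] charges to
[S_k], weighted by [M], is at most half of the surplus that [energy_f] leaves,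
weighted by [alpha]. *)
Lemma gamma_balance :
  M * (Lg * gamma / (4 * Lf)) <= alpha * ((2 - gamma) / 4) / 2.
Proof.
have M0 := max_gradient_ge0.
have den : 0 < 2 * M * Lg + alpha * Lf.
  by rewrite ltr_wpDl ?mulr_ge0 ?mulr_gt0.
move: gamma_le; rewrite ler_pdivlMr // => bal.
rewrite !mulrA ler_pdivrMr ?mulr_gt0 //; lra.
Qed.

(** The error bound converts the distance in [sharp_lower_bound] into a gap of
[g]. It is assumed on [Z] only, and [x k] is certain to lie there from [k = 1]
on. *)
Lemma gap_le_g k : (1 <= k)%N ->
  - (alpha * (A k * (f (x k) - f xs))) <= M * (A k * (g (x k) - g xs)).
Proof.
case: k => // k _.
have M0 := max_gradient_ge0.
have := ler_wpM2l (A_ge0 k.+1) (ler_wpM2l (ltW alpha_gt0)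
  (sharp_lower_bound (x k.+1))).
have := ler_wpM2l (A_ge0 k.+1)
  (ler_wpM2l M0 (g_heb _ (agm_x_in xyz_agm a_gt0 Z_convex k))).
lra.
Qed.

(** Writing [G] for the left-hand side, [energy_g] and [gamma_balance] bound [G]
by the logarithmic term plus half of [alpha] times the surplus in [energy_f];
that surplus is at most [alpha * D2 / 2] plus [G] by [gap_le_g], so half of [G]
is absorbed on the left. *)
Lemma weighted_gap_le k : (1 <= k)%N ->
  M * (A k * (g (x k) - g xs)) <=
  M * (gamma * Lg * D2 / Lf * (ln k%:R + 1)) + alpha * D2 / 2.
Proof.
move=> k1; have M0 := max_gradient_ge0.
have S0 : 0 <= S k by apply: sumr_ge0 => i _; exact: sqr_ge0.
have Eg := ler_wpM2l M0 (energy_g k).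
have T := ler_wpM2l M0 (sum_cut_slack_le k k1).
have Ef := ler_wpM2l (ltW alpha_gt0) (energy_f k).
have z0 := mulr_ge0 (ltW alpha_gt0) (sqr_ge0 (enorm (z k - xs))).
have bal := ler_wpM2r S0 gamma_balance.
have gap := gap_le_g k k1.
have TE : gamma * Lg * D2 / (2 * Lf) = gamma * Lg * D2 / Lf / 2.
  by field; rewrite gt_eqF.
rewrite TE in T; lra.
Qed.

End Rates.

Theorem theorem4p5 (R : realType) (n : nat)
  (N : 'rV[R]_n -> R) (N_norm : is_norm N)
  (N_le : forall v : 'rV[R]_n, N v <= enorm v)
  (Z : set 'rV[R]_n) (Z_nonempty : Z !=set0) (Z_closed : closed Z)
  (Z_convex : convex_set (M := 'rV[R]_n) Z)
  (f g : 'rV[R]_n -> R) (Lf Lg alpha gamma M : R)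
  (x0 xs : 'rV[R]_n) (gs : nat -> R)
  (x y z : nat -> 'rV[R]_n) (A : nat -> R)
  (g_smooth : exists U : set 'rV[R]_n,
     [/\ open U, join_point Z x0 `<=` U, convex_on U g & C1_on U g])
  (Lg_ge0 : 0 <= Lg)
  (g_lip : forall u v, join_point Z x0 u -> join_point Z x0 v ->
     dual_norm N (grad g u - grad g v) <= Lg * N (u - v))
  (f_convex : convex_on setT f) (f_C1 : C1_on setT f)
  (Lf_gt0 : 0 < Lf)
  (f_lip : forall u v, enorm (grad f u - grad f v) <= Lf * enorm (u - v))
  (xs_opt : argmin_on f (argmin_on g Z) xs)
  (alpha_gt0 : 0 < alpha)
  (g_heb : forall u, Z u -> alpha * dist N u (argmin_on g Z) <= g u - g xs)
  (M_max : is_max [set dual_norm N (grad f u) | u in argmin_on g Z] M)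
  (gamma_gt0 : 0 < gamma)
  (gamma_le : gamma <=
     Num.min (2 * alpha * Lf / (2 * M * Lg + alpha * Lf)) 1)
  (xyz_agm : agm_bio Z f g (fun k => gamma * (k.+1%:R / (4 * Lf))) gs
     x0 x y z A)
  (gs_bound : forall k, 0 <= gs k - g xs /\
     gs k - g xs <= 2 * Lg * enorm (x0 - xs) ^+ 2 / k.+1%:R ^+ 2) :
  let Cf := 4 * Lf * enorm (x0 - xs) ^+ 2 in
  let Cg := 8 * Lg * enorm (x0 - xs) ^+ 2 in
  forall k : nat, (1 <= k)%N ->
  [/\ f (x k) - f xs <= Cf / (gamma * k%:R * k.+1%:R),
      f (x k) - f xs >= - (Cg * M * (ln k%:R + 1) / (alpha * k%:R * k.+1%:R))
                        - Cf / (gamma * k%:R * k.+1%:R)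
    & 0 < M -> g (x k) - g xs <= Cg * (ln k%:R + 1) / (k%:R * k.+1%:R)
                        + alpha * Cf / (gamma * M * k%:R * k.+1%:R)].
Proof.
move=> Cf Cg k k1.
have [U [_ ZU g_convex g_C1]] := g_smooth.
have gs_ge j : g xs <= gs j by rewrite -subr_ge0; case: (gs_bound j).
have gs_le j := (gs_bound j).2.
move: gamma_le; rewrite le_min => /andP[gamma_le_ratio gamma_le1].
have AE := agm_A_eq Lf_gt0 xyz_agm k.
have k0 : 0 < k%:R :> R by rewrite ltr0n.
have k10 : 0 < k.+1%:R :> R by rewrite ltr0n.
have A0 : 0 < A k by rewrite AE divr_gt0 ?mulr_gt0.
have Ef := energy_f Z_convex ZU g_convex g_C1 f_convex f_C1 Lf_gt0 f_lip xs_opt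
  gamma_gt0 xyz_agm gs_ge k.
have Eg := weighted_gap_le N_norm N_le Z_convex ZU g_convex g_C1 Lg_ge0 g_lip
  f_convex f_C1 Lf_gt0 f_lip xs_opt gamma_gt0 xyz_agm gs_ge M_max alpha_gt0
  g_heb gs_le gamma_le_ratio k k1.
have gap := gap_le_g N_norm Z_convex f_convex f_C1 Lf_gt0 xs_opt gamma_gt0
  xyz_agm M_max alpha_gt0 g_heb k k1.
rewrite /Cf /Cg.
set D2 := enorm (x0 - xs) ^+ 2 in Ef Eg *.
set l := ln k%:R + 1 in Eg *.
have nz : [/\ k%:R != 0 :> R, k.+1%:R != 0 :> R, Lf != 0, gamma != 0
            & alpha != 0] by split; rewrite gt_eqF.
case: nz => kn k1n Lfn gn an.
split=> [||M0].
- rewrite -(ler_pM2l A0); apply: le_trans (_ : _ <= D2 / 2) _.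
    have : 0 <= (2 - gamma) / 4 * \sum_(i < k) enorm (z i.+1 - z i) ^+ 2.
      apply: mulr_ge0; first by lra.
      by apply: sumr_ge0 => i _; exact: sqr_ge0.
    have := sqr_ge0 (enorm (z k - xs)); lra.
  rewrite AE le_eqVlt; apply/orP; left; apply/eqP.
  move: (k%:R : R) (k.+1%:R : R) kn k1n => p q p0 q0; field.
  by rewrite ?gn ?Lfn ?p0 ?q0.
- rewrite -(ler_pM2l A0) -(ler_pM2l alpha_gt0) -lerN2.
  apply: le_trans gap _; apply: le_trans Eg _.
  rewrite AE le_eqVlt; apply/orP; left; apply/eqP.
  move: (k%:R : R) (k.+1%:R : R) kn k1n => p q p0 q0; field.
  by rewrite ?an ?gn ?Lfn ?p0 ?q0.
- rewrite -(ler_pM2l A0) -(ler_pM2l M0); apply: le_trans Eg _.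
  rewrite AE le_eqVlt; apply/orP; left; apply/eqP.
  move: (k%:R : R) (k.+1%:R : R) kn k1n => p q p0 q0; field.
  by rewrite ?gn ?Lfn ?p0 ?q0 ?gt_eqF.
Qed.
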